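(* Let $R>0$ and let $\partial B(0,R)=\{\omega\in\mathbb{R}^2 : |\omega|=R\}$. Let $g:\partial B(0,R)\to\mathbb{R}$ be a Borel measurable function such that $$g(\omega)+g(\omega_* )=g(\omega')+g(\omega_*')$$ for all $\omega,\omega_*,\omega',\omega_*'\in\partial B(0,R)$ satisfying $$\omega+\omega_*=\omega'+\omega_*'.$$ Then there is $A\in\mathbb{R}$ such that $$g(\omega)+g(-\omega)=A$$ for all $\omega\in\partial B(0,R)$.
   Context: Here $|\cdot|$ denotes the Euclidean norm on $\mathbb{R}^2$. The function $g$ is defined everywhere on the circle, and both the functional equation and the conclusion hold pointwise everywhere (not merely almost everywhere). *)

(* Defs.v *)
From HB Require Import structures.
From mathcomp Require Import all_boot all_order all_algebra.
From mathcomp Require Import all_classical all_reals all_analysis.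
Set Implicit Arguments.
Unset Strict Implicit.
Unset Printing Implicit Defensive.
Import Order.TTheory GRing.Theory Num.Theory.
Import numFieldNormedType.Exports.
Local Open Scope classical_set_scope.
Local Open Scope ring_scope.

(* The library norm on matrices is the sup norm, hence a separate definition. *)
Definition euclidean_norm (R : realType) (n : nat) (w : 'rV[R]_n) : R :=
  Num.sqrt (\sum_(i < n) w ord0 i ^+ 2).

Definition circle (R : realType) (r : R) : set 'rV[R]_2 :=
  [set w | euclidean_norm w = r].

(* The library puts no sigma-algebra on row vectors; this alias of 'rV[R]_n
   carries the one generated by the open sets. *)
Definition borel_rV (R : realType) (n : nat) :=
  g_sigma_algebraType (@open 'rV[R]_n).

(* For a Borel set D, this is Borel measurability of the restriction of g to D:
   the values of g outside D are irrelevant. *)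
Definition borel_measurable_on (R : realType) (n : nat)
    (D : set 'rV[R]_n) (g : 'rV[R]_n -> R) : Prop :=
  measurable_fun (D : set (borel_rV R n)) (g : borel_rV R n -> R).

(* [measurable_fun] is vacuous on a non-measurable domain; this rules it out. *)
Lemma measurable_circle (R : realType) (r : R) :
  measurable (circle r : set (borel_rV R 2)).
Proof.
have cn : continuous (@euclidean_norm R 2).
  have -> : @euclidean_norm R 2 =
      Num.sqrt \o (fun w => w ord0 ord0 ^+ 2 + w ord0 (lift ord0 ord0) ^+ 2).
    by apply/funext => w; rewrite /euclidean_norm big_ord_recl big_ord1.
  move=> w; apply: continuous_comp; last exact: sqrt_continuous.
  have cX j : {for w, continuous (fun w : 'rV[R]_2 => w ord0 j ^+ 2)}.
    apply: (@continuous_comp _ _ _ (fun w : 'rV[R]_2 => w ord0 j)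
      (fun x : R => x ^+ 2)); first exact: coord_continuous.
    exact: exprn_continuous.
  exact: cvgD (cX _) (cX _).
have /closed_openC openC : closed (circle r).
  by apply: (@preimage_closed _ _ (@euclidean_norm R 2) [set r]) => [w _|];
    [exact: cn | exact: closed_eq].
rewrite -(setCK (circle r)); apply: measurableC; exact: sub_sigma_algebra.
Qed.

(* Main.v *)
Require Import Defs.
From mathcomp Require Import all_boot all_order all_algebra.
From mathcomp Require Import all_classical all_reals all_analysis.
Import Order.TTheory GRing.Theory Num.Theory.
Import numFieldNormedType.Exports.
Local Open Scope classical_set_scope.
Local Open Scope ring_scope.

(** Antipodal pairs on the circle all have the same sum, namely 0. The
    functional equation therefore equates [g w + g (- w)] with its value at any
    fixed base point of the circle, and that value is the constant. *)

Lemma circleN (R : realType) (r : R) (w : 'rV[R]_2) :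
  circle r w -> circle r (- w).
Proof.
rewrite /circle /= /euclidean_norm => <-; congr Num.sqrt.
by apply: eq_bigr => i _; rewrite mxE sqrrN.
Qed.

Lemma circle_axis_point (R : realType) (r : R) :
  0 <= r -> circle r (r *: delta_mx ord0 ord0 : 'rV[R]_2).
Proof.
move=> r_ge0; rewrite /circle /= /euclidean_norm big_ord_recl big_ord1.
by rewrite !mxE /= mulr1 mulr0 expr0n addr0 sqrtr_sqr ger0_norm.
Qed.

Theorem proposition5p1 (R : realType) (r : R) (r_gt0 : 0 < r)
    (g : 'rV[R]_2 -> R) (g_meas : borel_measurable_on (circle r) g)
    (g_eq : forall w w_s w' w_s' : 'rV[R]_2,
      circle r w -> circle r w_s -> circle r w' -> circle r w_s' ->
      w + w_s = w' + w_s' -> g w + g w_s = g w' + g w_s') :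
  exists A : R, forall w : 'rV[R]_2, circle r w -> g w + g (- w) = A.
Proof.
set e : 'rV[R]_2 := r *: delta_mx ord0 ord0.
have circ_e : circle r e by exact: circle_axis_point (ltW r_gt0).
exists (g e + g (- e)) => w circ_w.
by apply: g_eq => //; [exact: circleN | exact: circleN | rewrite !subrr].
Qed.
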